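(* Let $G(x,y)\in\mathbb{Z}[x,y]$ be a squarefree homogeneous binary form of degree $4$ whose coefficients of $x^4$ and $y^4$ are nonzero, and let $X$ be the hypersurface \[ w^2 = z^3 + G(x,y)\, z \] in $\mathbb{P}_{\mathbb{Q}}(1,1,2,3)$. Let $c$ be the content of $G$ and write $G=cG_1$ with $G_1\in\mathbb{Z}[x,y]$. Suppose that $G_1$ has no fixed prime divisor, and write $G_1=\prod_i g_i$ with $g_i\in\mathbb{Z}[x,y]$ irreducible homogeneous forms. Assume that for some $i$ the number field $\mathbb{Q}[t]/(g_i(t,1))$ does not contain the group $\mu_4$ of fourth roots of unity (i.e. contains no primitive fourth root of unity). Finally assume that Tate–Shafarevich groups of elliptic curves over $\mathbb{Q}$ with $j$-invariant $1728$ are finite. Then $X(\mathbb{Q})$ is dense in $X$ for the Zariski topology.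
   Context: $\mathbb{P}_{\mathbb{Q}}(1,1,2,3)=\operatorname{Proj}\mathbb{Q}[x,y,z,w]$ with $x,y,z,w$ of weights $1,1,2,3$. The content of a polynomial with integer coefficients is the gcd of its coefficients. A homogeneous form $H(x,y)\in\mathbb{Z}[x,y]$ has a fixed prime divisor if there is a prime $p$ with $H(a,b)\in p\mathbb{Z}$ for all $a,b\in\mathbb{Z}$. *)

(* Defs.v *)
From HB Require Import structures.
From mathcomp Require Import all_boot all_order all_algebra all_field.
From Stdlib Require Rdefinitions.
From mathcomp Require Import Rstruct.
From mathcomp Require Import mpoly.

Set Implicit Arguments.
Unset Strict Implicit.
Unset Printing Implicit Defensive.

Import Order.TTheory GRing.Theory Num.Theory.
Local Open Scope ring_scope.

Local Notation R := Rdefinitions.R.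

(* In a binary form, variable 0 is x and variable 1 is y. *)
Definition pair_val (A : Type) (u v : A) : 'I_2 -> A :=
  fun i => if i == ord0 then u else v.

Definition content (n : nat) (G : {mpoly int[n]}) : int :=
  \big[gcdz/0]_(m <- msupp G) G@_m.

(* Squarefree as a form over Q: no nonconstant square divides G, whatever the
   square factors of the content of G. *)
Definition squarefree_form (G : {mpoly int[2]}) : Prop :=
  forall h q : {mpoly rat[2]},
    map_mpoly (fun a : int => a%:~R : rat) G = h ^+ 2 * q ->
    exists c : rat, h = c%:MP.

Definition has_fixed_prime_divisor (H : {mpoly int[2]}) : Prop :=
  exists2 p : nat, prime p &
    forall a b : int, (p%:Z %| H.@[pair_val a b])%Z.

Definition irreducible_elt (A : idomainType) (f : A) : Prop :=
  [/\ f != 0, f \isn't a GRing.unit &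
      forall g h : A, f = g * h -> g \is a GRing.unit \/ h \is a GRing.unit].

Definition dehomog (g : {mpoly int[2]}) : {poly rat} :=
  mmap (fun a : int => a%:~R : {poly rat}) (pair_val 'X 1) g.

(* Q[t]/(p).  The library quotient {poly %/ q} is the intended one only for q
   monic of positive degree, hence the normalization. *)
Definition quotQ (p : {poly rat}) : comNzRingType :=
  {poly %/ (lead_coef p)^-1 *: p}.

(* Variables 0, 1, 2, 3 are x, y, z, w, of weights 1, 1, 2, 3. *)
Definition wdeg (m : 'X_{1..4}) : nat :=
  (\sum_(i < 4) nth 0 [:: 1; 1; 2; 3] i * m i)%N.

Fact wdeg0 : wdeg 0%MM = 0%N.
Proof. by rewrite /wdeg big1 // => i _; rewrite mnm0E muln0. Qed.

Fact wdegD : {morph wdeg : m1 m2 / (m1 + m2)%MM >-> (m1 + m2)%N}.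
Proof.
move=> m1 m2; rewrite /wdeg -big_split /=.
by apply: eq_bigr => i _; rewrite mnmDE mulnDr.
Qed.

HB.instance Definition _ := isMeasure.Build 4 wdeg wdeg0 wdegD.

Definition is_ideal (I : {mpoly rat[4]} -> Prop) : Prop :=
  [/\ I 0, forall f g, I f -> I g -> I (f + g) & forall a f, I f -> I (a * f)].

Definition is_prime_ideal (I : {mpoly rat[4]} -> Prop) : Prop :=
  [/\ is_ideal I, ~ I 1 & forall f g, I (f * g) -> I f \/ I g].

Definition is_homog_ideal (I : {mpoly rat[4]} -> Prop) : Prop :=
  forall f, I f -> forall d : nat, I (pihomog wdeg d f).

Definition Proj (P : {mpoly rat[4]} -> Prop) : Prop :=
  [/\ is_prime_ideal P, is_homog_ideal P & exists i : 'I_4, ~ P 'X_i].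

Definition Vplus (S : {mpoly rat[4]} -> Prop) (P : {mpoly rat[4]} -> Prop) : Prop :=
  Proj P /\ forall f, S f -> P f.

Definition zariski_closed (Z : ({mpoly rat[4]} -> Prop) -> Prop) : Prop :=
  exists S : {mpoly rat[4]} -> Prop, forall P, Z P <-> Vplus S P.

Definition zariski_dense_in (A B : ({mpoly rat[4]} -> Prop) -> Prop) : Prop :=
  forall Z, zariski_closed Z -> (forall P, A P -> Z P) -> forall P, B P -> Z P.

(* The homogeneous prime of the rational point (a_0 : a_1 : a_2 : a_3). *)
Definition point_ideal (a : 'I_4 -> rat) (f : {mpoly rat[4]}) : Prop :=
  forall d : nat, (pihomog wdeg d f).@[a] = 0.

(* w^2 - z^3 - G(x,y) z *)
Definition surf_eq (G : {mpoly int[2]}) : {mpoly rat[4]} :=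
  'X_(inord 3) ^+ 2 - 'X_(inord 2) ^+ 3
  - mmap (fun a : int => a%:~R : {mpoly rat[4]})
         (pair_val 'X_(inord 0) 'X_(inord 1)) G * 'X_(inord 2).

Definition surf (G : {mpoly int[2]}) : ({mpoly rat[4]} -> Prop) -> Prop :=
  Vplus (fun f => f = surf_eq G).

(* X(Q) inside the underlying space of X.  As H^1(Q, G_m) = 0, every rational
   point of a weighted projective space has rational coordinates. *)
Definition surf_Q (G : {mpoly int[2]}) (P : {mpoly rat[4]} -> Prop) : Prop :=
  surf G P /\
  exists2 a : 'I_4 -> rat, (exists i, a i != 0) &
    forall f, P f <-> point_ideal a f.

(* y^2 + a1 x y + a3 y = x^3 + a2 x^2 + a4 x + a6 *)
Record weierstrass (F : Type) := Weierstrass {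
  wa1 : F; wa2 : F; wa3 : F; wa4 : F; wa6 : F }.

Definition wmap (F F' : Type) (f : F -> F') (E : weierstrass F) : weierstrass F' :=
  Weierstrass (f (wa1 E)) (f (wa2 E)) (f (wa3 E)) (f (wa4 E)) (f (wa6 E)).

Section Weierstrass.
Variables (F : fieldType) (E : weierstrass F).
Let a1 := wa1 E.
Let a2 := wa2 E.
Let a3 := wa3 E.
Let a4 := wa4 E.
Let a6 := wa6 E.

Definition wb2 : F := a1 ^+ 2 + 4 * a2.
Definition wb4 : F := 2 * a4 + a1 * a3.
Definition wb6 : F := a3 ^+ 2 + 4 * a6.
Definition wb8 : F :=
  a1 ^+ 2 * a6 + 4 * a2 * a6 - a1 * a3 * a4 + a2 * a3 ^+ 2 - a4 ^+ 2.
Definition wc4 : F := wb2 ^+ 2 - 24 * wb4.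
Definition wdisc : F :=
  - wb2 ^+ 2 * wb8 - 8 * wb4 ^+ 3 - 27 * wb6 ^+ 2 + 9 * wb2 * wb4 * wb6.
Definition wj : F := wc4 ^+ 3 / wdisc.

(* None is the point at infinity *)
Definition wpoint : Type := option (F * F).

Definition on_curve (P : wpoint) : Prop :=
  if P is Some (x, y) then
    y ^+ 2 + a1 * x * y + a3 * y = x ^+ 3 + a2 * x ^+ 2 + a4 * x + a6
  else True.

Definition wopp (P : wpoint) : wpoint :=
  if P is Some (x, y) then Some (x, - y - a1 * x - a3) else None.

Definition wadd (P Q : wpoint) : wpoint :=
  match P, Q with
  | None, _ => Q
  | _, None => P
  | Some (x1, y1), Some (x2, y2) =>
    if (x1 == x2) && (y1 + y2 + a1 * x2 + a3 == 0) then None else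
    let l :=
      if x1 == x2
      then (3 * x1 ^+ 2 + 2 * a2 * x1 + a4 - a1 * y1) / (2 * y1 + a1 * x1 + a3)
      else (y2 - y1) / (x2 - x1) in
    let x3 := l ^+ 2 + a1 * l - a2 - x1 - x2 in
    Some (x3, - (l * (x3 - x1) + y1) - a1 * x3 - a3)
  end.

Definition wsub (P Q : wpoint) : wpoint := wadd P (wopp Q).

End Weierstrass.

Definition pmap_pt (F F' : fieldType) (f : F -> F') (P : wpoint F) : wpoint F' :=
  omap (fun p => (f p.1, f p.2)) P.

(* Gal(Qbar/Q), with Qbar = algC: a ring endomorphism of an algebraic extension
   that fixes the base field is an automorphism. *)
Notation GalQ := {rmorphism algC -> algC}.

Definition Qbar_curve (E : weierstrass rat) : weierstrass algC :=
  wmap (@ratr algC) E.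

(* The second clause is continuity: xi factors through the Galois group of a
   finite extension, for the discrete topology on E(Qbar). *)
Definition is_cocycle (E : weierstrass rat) (xi : GalQ -> wpoint algC) : Prop :=
  [/\ forall s : GalQ, on_curve (Qbar_curve E) (xi s),
      exists S : seq algC,
        forall s t : GalQ, {in S, s =1 t} -> xi s = xi t
    & forall s t st : GalQ, st =1 s \o t ->
        xi st = wadd (Qbar_curve E) (xi s) (pmap_pt s (xi t))].

Definition cohomologous (E : weierstrass rat) (xi eta : GalQ -> wpoint algC) : Prop :=
  exists2 P : wpoint algC, on_curve (Qbar_curve E) P &
    forall s : GalQ,
      wsub (Qbar_curve E) (xi s) (eta s) = wsub (Qbar_curve E) (pmap_pt s P) P.

Definition is_absolute_value (K : fieldType) (v : K -> R) : Prop :=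
  [/\ forall x, 0 <= v x,
      forall x, v x = 0 <-> x = 0,
      forall x y, v (x * y) = v x * v y
    & forall x y, v (x + y) <= v x + v y].

(* (K, v) is the completion of Q at the place given by the restriction of v;
   a place is a class of nontrivial absolute values, so K ranges over the real
   numbers and the p-adic fields. *)
Definition is_completion (K : fieldType) (j : {rmorphism rat -> K}) (v : K -> R) : Prop :=
  [/\ is_absolute_value v,
      exists2 q : rat, q != 0 & v (j q) <> 1,
      forall (x : K) (e : R), 0 < e -> exists q : rat, v (x - j q) < e
    & forall u : nat -> K,
        (forall e : R, 0 < e -> exists N : nat,
           forall m n : nat, (N <= m)%N -> (N <= n)%N -> v (u m - u n) < e) ->
        exists x : K, forall e : R, 0 < e -> exists N : nat,
           forall n : nat, (N <= n)%N -> v (u n - x) < e].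

Definition is_algebraic_closure (K L : fieldType) (k : {rmorphism K -> L}) : Prop :=
  GRing.closed_field_axiom L /\ forall x : L, algebraicOver k x.

(* The restriction of the class of xi along i : Qbar -> L is trivial in
   H^1(Gal(L/K), E(L)); t is the restriction of s to Qbar. *)
Definition trivial_over (E : weierstrass rat) (K L : fieldType)
    (k : {rmorphism K -> L}) (i : {rmorphism algC -> L})
    (xi : GalQ -> wpoint algC) : Prop :=
  exists2 P : wpoint L, on_curve (wmap i (Qbar_curve E)) P &
    forall s : {rmorphism L -> L}, (forall x : K, s (k x) = k x) ->
    forall t : GalQ, (forall x : algC, i (t x) = s (i x)) ->
      pmap_pt i (xi t) = wsub (wmap i (Qbar_curve E)) (pmap_pt s P) P.

(* xi represents an element of
   Sha(E/Q) = Ker (H^1(Q, E) -> \prod_v H^1(Q_v, E)); triviality at v does not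
   depend on the choices of L and i. *)
Definition in_sha (E : weierstrass rat) (xi : GalQ -> wpoint algC) : Prop :=
  is_cocycle E xi /\
  forall (K : fieldType) (j : {rmorphism rat -> K}) (v : K -> R),
    is_completion j v ->
  forall (L : fieldType) (k : {rmorphism K -> L}), is_algebraic_closure k ->
  forall i : {rmorphism algC -> L}, trivial_over E k i xi.

Definition sha_finite (E : weierstrass rat) : Prop :=
  exists (n : nat) (eta : 'I_n -> GalQ -> wpoint algC),
    (forall i, in_sha E (eta i)) /\
    forall xi, in_sha E xi -> exists i, cohomologous E xi (eta i).

(* Main.v *)
Require Import Defs.
From mathcomp Require Import all_boot all_order all_algebra all_field.
From mathcomp Require Import mpoly.
From mathcomp Require Import ring lra zify.
Import Order.TTheory GRing.Theory Num.Theory.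
Local Open Scope ring_scope.
Set Implicit Arguments.
Unset Strict Implicit.
Unset Printing Implicit Defensive.

(** [X] carries an explicit multisection (in this shape due to Ulas).  Write
    [g t = G (1, t)].  Substituting [z = a q^2 s^2] with [a = g al] and
    [t = al + s], the equation asks that [a (g t + a^2 q^4 s^4)] be a square.
    Its Taylor polynomial in [s] starts with [a^2], so completing the square
    up to [s^2] leaves a multiple of [s^3 (s D - delta)], whose root
    [s = delta / D] is nonzero unless [delta], a covariant of [g] at [al],
    vanishes.  Modulo [g] that covariant is [g' ^ 3], so it is not identically
    zero when [g] is squarefree.

    For [q = 2 ^- m] with [m] large, the point is small 2-adically compared with
    [g t].  One doubling on the fibre makes it large, and each further doubling
    multiplies its 2-adic size by 4, so the fibre has infinitely many rational
    points.  Infinitely many such fibres give density. *)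

(** * The 2-adic absolute value on the rationals *)

(** Values are taken in [rat], so that all estimates stay there. Zero needs its own clause: as
    [logn 2 0 = 0], the quotient would give 1. *)
Definition abs2 (x : rat) : rat :=
  if x == 0 then 0
  else 2 ^+ logn 2 `|denq x|%N / 2 ^+ logn 2 `|numq x|%N.

Lemma abs2_0 : abs2 0 = 0.
Proof. by rewrite /abs2 eqxx. Qed.

Lemma abs2_gt0 x : (0 < abs2 x) = (x != 0).
Proof.
by rewrite /abs2; case: eqP => //= _; rewrite divr_gt0 // exprn_gt0.
Qed.

Lemma abs2_ge0 x : 0 <= abs2 x.
Proof. by rewrite /abs2; case: eqP => // _; rewrite divr_ge0 // exprn_ge0. Qed.

(** Cross-multiplying with the reduced fraction gives an identity of integers, whose exponents of 2
    can be compared. *)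
Lemma abs2_frac (n d : int) : n != 0 -> d != 0 ->
  abs2 (n%:~R / d%:~R) = 2 ^+ logn 2 `|d|%N / 2 ^+ logn 2 `|n|%N.
Proof.
move=> n0 d0; set x : rat := n%:~R / d%:~R.
have x0 : x != 0 by apply: mulf_neq0; rewrite ?invr_eq0 intr_eq0.
rewrite /abs2 (negPf x0).
have nx0 : numq x != 0 by rewrite numq_eq0.
have e : (numq x * d = n * denq x)%R.
  apply/eqP; rewrite -(eqr_int rat) !intrM; apply/eqP.
  have : (numq x)%:~R / (denq x)%:~R = n%:~R / d%:~R :> rat by rewrite divq_num_den.
  move/eqP; rewrite eqr_div ?intr_eq0 ?denq_neq0 // => /eqP ->; ring.
apply/eqP; rewrite eqr_div ?expf_neq0 //; apply/eqP.
rewrite -!exprD; congr (_ ^+ _).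
have := congr1 (fun m => logn 2 (absz m)) e.
by rewrite /= !abszM !lognM ?absz_gt0 ?denq_neq0 //; lia.
Qed.

Lemma abs2M : {morph abs2 : x y / x * y}.
Proof.
move=> x y; have [->|x0] := eqVneq x 0; first by rewrite !(mul0r, abs2_0).
have [->|y0] := eqVneq y 0; first by rewrite !(mulr0, abs2_0).
rewrite -{1}[x]divq_num_den -{1}[y]divq_num_den mulf_div -!intrM.
rewrite abs2_frac ?mulf_neq0 ?numq_eq0 ?denq_neq0 //.
rewrite /abs2 (negPf x0) (negPf y0) !abszM.
rewrite !lognM ?absz_gt0 ?numq_eq0 ?denq_neq0 // !exprD.
by field; rewrite !expf_neq0.
Qed.

Lemma abs2_1 : abs2 1 = 1.
Proof. by rewrite -[1 in LHS](divr1 (1%:~R : rat)) (@abs2_frac 1 1) //= divr1. Qed.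

Lemma abs2X x n : abs2 (x ^+ n) = abs2 x ^+ n.
Proof. by elim: n => [|n IH]; rewrite ?abs2_1 // !exprS abs2M IH. Qed.

Lemma abs2V x : abs2 x^-1 = (abs2 x)^-1.
Proof.
have [->|x0] := eqVneq x 0; first by rewrite !(invr0, abs2_0).
have := abs2M x x^-1; rewrite divff // abs2_1 => e.
have a0 : abs2 x != 0 by rewrite gt_eqF ?abs2_gt0.
by apply: (mulfI a0); rewrite divff.

Qed.

Lemma abs2_2 : abs2 2 = 2^-1.
Proof. by rewrite -[2 in LHS]divr1 (@abs2_frac 2 1) //= mul1r. Qed.

Lemma abs2N x : abs2 (- x) = abs2 x.
Proof.
have: abs2 (-1) ^+ 2 = 1 by rewrite -abs2X sqrrN expr1n abs2_1.
move/eqP; rewrite sqrf_eq1 => /orP [] /eqP e; last first.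
  by have := abs2_ge0 (-1); rewrite e; lra.
by rewrite -mulN1r abs2M e mul1r.
Qed.

Lemma abs2_int_le1 (n : int) : abs2 n%:~R <= 1.
Proof.
have [->|n0] := eqVneq n 0; first by rewrite abs2_0.
rewrite -[_%:~R](divr1) (@abs2_frac n 1) //= mul1r.
by rewrite invf_le1 ?exprn_gt0 ?exprn_ege1.
Qed.

(** An even denominator in lowest terms would force an odd numerator, hence absolute value above
    1. *)
Lemma abs2_le1_frac (x : rat) : abs2 x <= 1 ->
  exists2 d : int, abs2 d%:~R = 1 & exists n : int, x = n%:~R / d%:~R.
Proof.
have [->|x0] := eqVneq x 0.
  by exists 1; [rewrite abs2_1 | exists 0; rewrite mul0r].
move=> h; exists (denq x); last by exists (numq x); rewrite divq_num_den.
rewrite -[_%:~R](divr1) (@abs2_frac _ 1) ?denq_neq0 //= mul1r.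
suff -> : logn 2 `|denq x| = 0%N by rewrite expr0 invr1.
apply/eqP; rewrite -leqn0 leqNgt; apply/negP => lt0.
have nx0 : (0 < `|numq x|)%N by rewrite absz_gt0 numq_eq0.
have dvd2 : (2 %| `|denq x|)%N by move: lt0; rewrite logn_gt0 mem_primes => /and3P [].
have ndvd : ~~ (2 %| `|numq x|)%N.
  apply/negP => dn; have := coprime_num_den x; rewrite /coprime.
  have : (2 %| gcdn `|numq x| `|denq x|)%N by rewrite dvdn_gcd dn.
  by move=> h2 /eqP h1; rewrite h1 in h2.
have l0 : logn 2 `|numq x| = 0%N.
  by apply/eqP; rewrite -leqn0 leqNgt logn_gt0 mem_primes negb_and negb_and ndvd !orbT.
move: h; rewrite /abs2 (negPf x0) l0 expr0 divr1.
by apply/negP; rewrite -ltNge exprn_egt1 // -lt0n.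
Qed.

Lemma abs2D_le1 x : abs2 x <= 1 -> abs2 (1 + x) <= 1.
Proof.
move=> /abs2_le1_frac [d d1 [n ->]].
have d0 : (d%:~R : rat) != 0 by rewrite -abs2_gt0 d1.
have -> : 1 + n%:~R / d%:~R = (d + n)%:~R / d%:~R :> rat by rewrite intrD; field.
by rewrite abs2M abs2V d1 invr1 mulr1 abs2_int_le1.
Qed.

(** Dividing by the larger term reduces the ultrametric inequality to [abs2D_le1], which adds
    fractions with odd denominator. *)
Lemma abs2D x y : abs2 (x + y) <= Num.max (abs2 x) (abs2 y).
Proof.
wlog le : x y / abs2 y <= abs2 x.
  move=> W; case/orP: (le_total (abs2 y) (abs2 x)) => /W //.
  by rewrite addrC maxC.
rewrite le_max; apply/orP; left.
have [x0|x0] := eqVneq x 0.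
  by move: le; rewrite x0 abs2_0 add0r.
have -> : x + y = x * (1 + y / x) by field.
rewrite abs2M ler_piMr ?abs2_ge0 //; apply: abs2D_le1.
by rewrite abs2M abs2V ler_pdivrMr ?mul1r ?abs2_gt0.
Qed.

(** Otherwise [x = (x + y) - y] would be a sum of two terms smaller than [x]. *)
Lemma abs2D_lt x y : abs2 y < abs2 x -> abs2 (x + y) = abs2 x.
Proof.
move=> lt; apply/eqP; rewrite eq_le; apply/andP; split.
  by have := abs2D x y; rewrite (max_idPl (ltW lt)).
have := abs2D (x + y) (- y); rewrite addrK abs2N le_max.
by case/orP => // h; have := lt_le_trans lt h; rewrite ltxx.
Qed.

(** * Zeros of polynomials in one variable *)

Lemma poly_eq0_inj_roots (R : idomainType) (p : {poly R}) (x : nat -> R) :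
  injective x -> (forall n, p.[x n] = 0) -> p = 0.
Proof.
move=> inj_x px0; apply: (@roots_geq_poly_eq0 _ _ [seq x i | i <- iota 0 (size p)]).
- by apply/allP => _ /mapP [i _ ->]; apply/eqP/px0.
- by rewrite map_inj_uniq ?iota_uniq.
- by rewrite size_map size_iota.
Qed.

Lemma poly_non_root (R : numDomainType) (p : {poly R}) :
  p != 0 -> exists x, p.[x] != 0.
Proof.
move=> p0; have [//|all0] := boolP [exists i : 'I_(size p).+1, p.[i%:R] != 0].
  by case/existsP=> i pi; exists i%:R.
case/negP: p0; apply/eqP.
apply: (@roots_geq_poly_eq0 _ _ [seq i%:R | i <- iota 0 (size p)]).
- apply/allP => _ /mapP [i + ->]; rewrite mem_iota add0n => /andP [_ lt_i].
  apply: contraR all0 => pi; apply/existsP.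
  by exists (inord i); rewrite inordK // ltnS ltnW.
- by rewrite map_inj_uniq ?iota_uniq // => i j /eqP; rewrite eqr_nat => /eqP.
- by rewrite size_map size_iota.
Qed.

(** * Doubling on a fibre and 2-adic size *)

(** The first coordinate of twice a point on [w ^ 2 = z ^ 3 + N z], with [w ^ 2] replaced by
    [z (z ^ 2 + N)] in the denominator. *)
Definition double_x (N z : rat) : rat := (z ^+ 2 - N) ^+ 2 / (4 * z * (z ^+ 2 + N)).

Lemma double_x_on_curve (N z : rat) : z != 0 -> z ^+ 2 + N != 0 ->
  (exists w, w ^+ 2 = z ^+ 3 + N * z) ->
  exists w, w ^+ 2 = double_x N z ^+ 3 + N * double_x N z.
Proof.
move=> z0 zN0 [w ew].
have ew' : w ^+ 2 = z * (z ^+ 2 + N) by rewrite ew; ring.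
have w0 : w != 0.
  by apply: contra_eq_neq ew' => ->; rewrite expr0n eq_sym mulf_neq0.
(* This is the second coordinate of the double. *)
exists ((z ^+ 2 - N) * (z ^+ 4 + 6 * N * z ^+ 2 + N ^+ 2) / (8 * w ^+ 3)).
have -> : double_x N z = (z ^+ 2 - N) ^+ 2 / (4 * w ^+ 2).
  by rewrite ew' /double_x -!mulrA.
(* Eliminating [N] leaves an identity of rational functions in [w] and [z]. *)
have -> : N = w ^+ 2 / z - z ^+ 2 by rewrite ew; field.
by field; rewrite w0 z0.
Qed.

(** Both [z ^ 2 + N] and [z ^ 2 - N] have the size of [z ^ 2], so the growth comes only from the 4
    in the denominator, of size 1/4. *)
Lemma abs2_double_x (N z : rat) : abs2 N < abs2 z ^+ 2 ->
  [/\ z != 0, z ^+ 2 + N != 0 & abs2 (double_x N z) = 4 * abs2 z].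
Proof.
move=> lt.
have z0 : z != 0.
  by apply: contraTneq lt => ->; rewrite abs2_0 expr0n -leNgt abs2_ge0.
have e1 : abs2 (z ^+ 2 + N) = abs2 z ^+ 2 by rewrite abs2D_lt abs2X.
have e2 : abs2 (z ^+ 2 - N) = abs2 z ^+ 2 by rewrite abs2D_lt abs2X ?abs2N.
have a0 : abs2 z != 0 by rewrite gt_eqF ?abs2_gt0.
split=> //; first by rewrite -abs2_gt0 e1 exprn_gt0 ?abs2_gt0.
have -> : double_x N z = (z ^+ 2 - N) ^+ 2 / (2 ^+ 2 * z * (z ^+ 2 + N)).
  by rewrite /double_x; congr (_ / (_ * _ * _)); ring.
by rewrite !(abs2M, abs2V, abs2X) e1 e2 abs2_2; field.
Qed.

(** The bound on [N] persists under doubling, and the iterates have the distinct sizes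
    [4 ^ k * abs2 z]. *)
Lemma infinite_fibre_gt (N z : rat) (zs := fun k => iter k (double_x N) z) :
  abs2 N < abs2 z ^+ 2 -> (exists w, w ^+ 2 = z ^+ 3 + N * z) ->
  injective zs /\ forall k, exists2 w, w != 0 & w ^+ 2 = zs k ^+ 3 + N * zs k.
Proof.
move=> ltN ez.
have inv k : [/\ abs2 (zs k) = 4 ^+ k * abs2 z, abs2 N < abs2 (zs k) ^+ 2
             & exists w, w ^+ 2 = zs k ^+ 3 + N * zs k].
  elim: k => [|k [ek ltk wk]]; first by rewrite /zs /= mul1r.
  have [z0 zN0 e4] := abs2_double_x ltk.
  rewrite /zs iterS -/(zs k) e4; split.
  - by rewrite ek exprS mulrA.
  - by apply: lt_le_trans ltk _; rewrite exprMn ler_peMl ?sqr_ge0.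
  - exact: double_x_on_curve.
split=> [i j eij|k].
  have [ei _ _] := inv i; have [ej _ _] := inv j.
  have z0 : abs2 z != 0.
    by have [z0 _ _] := abs2_double_x ltN; rewrite gt_eqF ?abs2_gt0.
  move: ei; rewrite eij ej => /(mulIf z0).
  by move/(ieexprIn (x := 4 : rat)) => ->.
have [_ ltk [w ew]] := inv k; exists w => //.
have [z0 zN0 _] := abs2_double_x ltk.
apply: contra_eq_neq ew => ->; rewrite expr0n eq_sym.
have -> : zs k ^+ 3 + N * zs k = zs k * (zs k ^+ 2 + N) by ring.
exact: mulf_neq0.
Qed.

(** Here [N] dominates [z ^ 2], so the first double has size [4 * abs2 N / abs2 z]. Its square
    exceeds [abs2 N], and [infinite_fibre_gt] applies from there on. *)
Lemma infinite_fibre (N z : rat)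
  (zs := fun k => iter k (double_x N) (double_x N z)) :
  z != 0 -> abs2 z ^+ 2 < abs2 N -> (exists w, w ^+ 2 = z ^+ 3 + N * z) ->
  injective zs /\ forall k, exists2 w, w != 0 & w ^+ 2 = zs k ^+ 3 + N * zs k.
Proof.
move=> z0 lt ez.
have e1 : abs2 (z ^+ 2 + N) = abs2 N by rewrite addrC abs2D_lt ?abs2X.
have e2 : abs2 (z ^+ 2 - N) = abs2 N.
  by rewrite addrC abs2D_lt ?abs2X ?abs2N.
have az0 : 0 < abs2 z by rewrite abs2_gt0.
have aN0 : 0 < abs2 N by apply: le_lt_trans lt; rewrite sqr_ge0.
have zN0 : z ^+ 2 + N != 0 by rewrite -abs2_gt0 e1.
apply: infinite_fibre_gt; last exact: double_x_on_curve.
have -> : double_x N z = (z ^+ 2 - N) ^+ 2 / (2 ^+ 2 * z * (z ^+ 2 + N)).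
  by rewrite /double_x; congr (_ / (_ * _ * _)); ring.
have -> : abs2 ((z ^+ 2 - N) ^+ 2 / (2 ^+ 2 * z * (z ^+ 2 + N)))
          = 4 * abs2 N / abs2 z.
  by rewrite !(abs2M, abs2V, abs2X) e1 e2 abs2_2; field; rewrite !gt_eqF.
rewrite expr_div_n ltr_pdivlMr ?exprn_gt0 // exprMn [_ ^+ 2 * _]mulrC.
rewrite [abs2 N ^+ 2]expr2 -mulrA ltr_pM2l //; apply: lt_le_trans lt _.
by rewrite ler_peMr // ltW.
Qed.

(** * Infinitely many fibres from one good parameter *)

Lemma exists_exp2_gt (C : rat) : exists M : nat,
  forall m, (M <= m)%N -> C < 2 ^+ m.
Proof.
have [M lt] : exists M : nat, `|C| < M%:R.
  by exists (Num.bound `|C|); apply: archi_boundP.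
exists M => m le; apply: le_lt_trans (ler_norm C) _; apply: lt_trans lt _.
by rewrite -natrX ltr_nat (leq_ltn_trans le) // ltn_expl.
Qed.

Lemma le_sum4 (x y z t : rat) : 0 <= x -> 0 <= y -> 0 <= z -> 0 <= t ->
  [/\ x <= x + y + z + t, y <= x + y + z + t, z <= x + y + z + t
     & t <= x + y + z + t].
Proof. by move=> x0 y0 z0 t0; split; lra. Qed.

Lemma abs2_horner_le (a b c d B : rat) (s : rat) : abs2 s <= 1 ->
  [/\ abs2 a <= B, abs2 b <= B, abs2 c <= B & abs2 d <= B] ->
  abs2 (a + s * (b + s * (c + s * d))) <= B.
Proof.
move=> s1 [aB bB cB dB].
have H x y : abs2 x <= B -> abs2 y <= B -> abs2 (x + s * y) <= B.
  move=> xB yB; apply: le_trans (abs2D _ _) _.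
  rewrite ge_max xB abs2M /=; apply: le_trans yB.
  by rewrite ler_piMl ?abs2_ge0.
by do 3! apply: (H) => //.
Qed.

(* Here [a g(al + s) + a^3 q^4 s^4] and the square of [a + b s / 2 + k s^2] agree
   up to [s^2], by the choice of [k]; the second hypothesis on [s] makes the
   remaining terms agree. *)
Lemma point_on_fibre (a b c d e q k s : rat) : a != 0 ->
  8 * a * k = 4 * a * c - b ^+ 2 ->
  s * (k ^+ 2 - a * e - a ^+ 3 * q ^+ 4) = a * d - b * k ->
  (q * s * (a + b * s / 2 + k * s ^+ 2)) ^+ 2
  = (a * q ^+ 2 * s ^+ 2) ^+ 3
    + (a + s * (b + s * (c + s * (d + s * e)))) * (a * q ^+ 2 * s ^+ 2).
Proof.
move=> a0 ek es.
have -> : c = (8 * a * k + b ^+ 2) / (4 * a) by rewrite ek; field.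
(* With [c] eliminated, the two sides differ by [q ^ 2 * s ^ 5] times the defect in the condition on
   [s]. *)
apply/eqP; rewrite -subr_eq0; apply/eqP.
transitivity (q ^+ 2 * s ^+ 5 *
  (s * (k ^+ 2 - a * e - a ^+ 3 * q ^+ 4) - (a * d - b * k))); first by field.
by rewrite es subrr mulr0.
Qed.

(** The [n]-th fibre uses [q = 2 ^- (M + n)]. The term with [q ^ 4] then dominates the denominator
    of [s], so the size of [s n] strictly decreases with [n] and the fibres are distinct. *)
Lemma infinitely_many_fibres (g : {poly rat}) (al : rat) : (size g <= 5)%N ->
  let a := g.[al] in let b := g^`N(1).[al] in
  let c := g^`N(2).[al] in let d := g^`N(3).[al] in
  a != 0 -> 8 * a ^+ 2 * d - 4 * a * b * c + b ^+ 3 != 0 ->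
  exists (t : nat -> rat) (zs : nat -> nat -> rat),
    [/\ injective t, forall n, injective (zs n)
      & forall n k, exists2 w, w != 0 &
          w ^+ 2 = zs n k ^+ 3 + g.[t n] * zs n k].
Proof.
move=> sg a b c d a0 T0; pose e := g^`N(4).[al].
pose k := (4 * a * c - b ^+ 2) / (8 * a).
have ek : 8 * a * k = 4 * a * c - b ^+ 2 by rewrite /k; field.
pose de := a * d - b * k; pose kap := k ^+ 2 - a * e.
have de0 : de != 0.
  (* The nonvanishing hypothesis is about [8 * a * de]. *)
  have -> : de = (8 * a ^+ 2 * d - 4 * a * b * c + b ^+ 3) / (8 * a).
    by rewrite /de /k; field.
  by rewrite mulf_neq0 // invr_eq0 mulf_neq0.
have Aa : 0 < abs2 a by rewrite abs2_gt0.
have Ad : 0 < abs2 de by rewrite abs2_gt0.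
pose B := abs2 b + abs2 c + abs2 d + abs2 e.
have B0 : 0 <= B by rewrite !addr_ge0 ?abs2_ge0.
pose A := abs2 a; pose D := abs2 de.
(* The four terms serve in turn to give: [a ^ 3 * q ^ 4] dominates [kap]; [s] has size at most 1;
   [g] has the same size at [al + s] as at [al]; [z ^ 2] is smaller than that value. *)
pose C := abs2 kap / A ^+ 3 + D / A ^+ 3 + B * D / A ^+ 4 + D ^+ 4 / A ^+ 11.
have [M hM] := exists_exp2_gt C.
have [C1 C2 C3 C4] :
  [/\ abs2 kap / A ^+ 3 <= C, D / A ^+ 3 <= C, B * D / A ^+ 4 <= C
     & D ^+ 4 / A ^+ 11 <= C].
  by apply: le_sum4; rewrite !(divr_ge0, mulr_ge0, exprn_ge0, abs2_ge0).
pose q n : rat := 2 ^- (M + n).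
pose den n := kap - a ^+ 3 * q n ^+ 4.
pose s n := de / den n.
have absq n : abs2 (q n) = 2 ^+ (M + n).
  by rewrite abs2V abs2X abs2_2 exprVn invrK.
have u1 n : 1 <= 2 ^+ (M + n) :> rat by rewrite exprn_ege1.
have uC n j : C < (2 ^+ (M + n)) ^+ j.+1.
  apply: lt_le_trans (hM _ (leq_addr n M)) _.
  by rewrite exprS ler_peMr ?exprn_ege1 // (le_trans ler01).
have absden n : abs2 (den n) = A ^+ 3 * (2 ^+ (M + n)) ^+ 4.
  rewrite /den addrC abs2D_lt abs2N abs2M !abs2X absq //.
  rewrite -ltr_pdivrMl ?exprn_gt0 // mulrC.
  exact: le_lt_trans C1 (uC _ _).
have den0 n : den n != 0.
  by rewrite -abs2_gt0 absden mulr_gt0 // exprn_gt0 // exprn_gt0.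
have abss n : abs2 (s n) = D / (A ^+ 3 * (2 ^+ (M + n)) ^+ 4).
  by rewrite abs2M abs2V absden.
have u0 n j : 0 < (2 ^+ (M + n)) ^+ j :> rat by rewrite !exprn_gt0.
have sle1 n : abs2 (s n) <= 1.
  rewrite abss ler_pdivrMr ?mulr_gt0 ?exprn_gt0 // mul1r.
  rewrite -ler_pdivrMl ?exprn_gt0 // mulrC.
  by apply: ltW; apply: le_lt_trans C2 (uC _ _).
have taylor n : g.[al + s n]
    = a + s n * (b + s n * (c + s n * (d + s n * e))).
  rewrite (nderiv_taylor_wide (mulrC _ _) sg) !big_ord_recl big_ord0 /=.
  rewrite /bump /= nderivn0 -/a -/b -/c -/d -/e; ring.
have absN n : abs2 g.[al + s n] = A.
  rewrite taylor abs2D_lt // abs2M.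
  have le : abs2 (b + s n * (c + s n * (d + s n * e))) <= B.
    by apply: abs2_horner_le => //; apply: le_sum4; apply: abs2_ge0.
  apply: le_lt_trans (ler_wpM2l (abs2_ge0 _) le) _; rewrite abss mulrAC.
  rewrite ltr_pdivrMr ?mulr_gt0 ?exprn_gt0 // mulrA -exprS.
  rewrite -ltr_pdivrMl ?exprn_gt0 // mulrC [D * B]mulrC.
  exact: le_lt_trans C3 (uC _ _).
pose t n := al + s n; pose z n := a * q n ^+ 2 * s n ^+ 2.
suff fib n : injective (fun k => iter k (double_x g.[t n]) (double_x g.[t n] (z n)))
    /\ forall k (zk := iter k (double_x g.[t n]) (double_x g.[t n] (z n))),
         exists2 w, w != 0 & w ^+ 2 = zk ^+ 3 + g.[t n] * zk.
  exists t, (fun n k => iter k (double_x g.[t n]) (double_x g.[t n] (z n))).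
  split=> [i j /addrI eij|n|n]; [|exact: (fib n).1|exact: (fib n).2].
  (* The exponent of 2 in the size of [s n] recovers [n]. *)
  have := abss i; rewrite eij abss => /(mulfI (lt0r_neq0 Ad)) /invr_inj.
  move/(mulfI (expf_neq0 3 (lt0r_neq0 Aa))); rewrite -!exprM.
  by move/(ieexprIn (x := 2 : rat)) => /(_ isT isT); lia.
apply: infinite_fibre; rewrite /z /t.
- by rewrite !mulf_neq0 ?expf_neq0 ?invr_eq0 ?expf_neq0 ?mulf_neq0 ?invr_eq0.
- rewrite absN abs2M abs2M !abs2X absq abss -/A.
  have -> : (A * (2 ^+ (M + n)) ^+ 2 * (D / (A ^+ 3 * (2 ^+ (M + n)) ^+ 4)) ^+ 2) ^+ 2
      = D ^+ 4 / (A ^+ 10 * (2 ^+ (M + n)) ^+ 12).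
    by field; rewrite expf_neq0 // gt_eqF.
  rewrite ltr_pdivrMr ?mulr_gt0 ?exprn_gt0 // mulrA -exprS.
  rewrite -ltr_pdivrMl ?exprn_gt0 // mulrC.
  exact: le_lt_trans C4 (uC _ _).
- exists (q n * s n * (a + b * s n / 2 + k * s n ^+ 2)).
  rewrite taylor; apply: point_on_fibre => //.
  by rewrite /s -/kap -/(den n) divfK.
Qed.

(** In characteristic 0, squarefree gives [g] coprime to its derivative. If [T] vanished, [g] would
    divide the cube of that derivative and so be constant. A non-root of [g * T] is then the
    required parameter. *)
Lemma exists_good_parameter (g : {poly rat}) : (1 < size g)%N ->
  (forall h r : {poly rat}, g = h ^+ 2 * r -> (size h <= 1)%N) ->
  exists al, g.[al] != 0 /\
   8 * g.[al] ^+ 2 * g^`N(3).[al] - 4 * g.[al] * g^`N(1).[al] * g^`N(2).[al]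
     + g^`N(1).[al] ^+ 3 != 0.
Proof.
move=> sg sqf.
have g0 : g != 0 by rewrite -size_poly_gt0 ltnW.
pose T := 8%:P * g ^+ 2 * g^`N(3) - 4%:P * g * g^`N(1) * g^`N(2) + g^`N(1) ^+ 3.
have cop : coprimep g g^`().
  have : separable_poly g; last by rewrite separable_poly.unlock.
  apply/separable_polyP; split=> [u v uv_g|u ug su].
    rewrite /coprimep eqn_leq; apply/andP; split; last first.
      rewrite size_poly_gt0 gcdp_eq0; apply/negP => /andP [/eqP u0 _].
      by move: uv_g; rewrite u0 mul0r dvd0p (negPf g0).
    have : gcdp u v ^+ 2 %| g.
      by apply: dvdp_trans uv_g; rewrite expr2 dvdp_mul ?dvdp_gcdl ?dvdp_gcdr.
    by case/dvdpP => r; rewrite mulrC => /sqf.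
  have lu : lead_coef u != 0 by rewrite lead_coef_eq0 -size_poly_gt0 ltnW.
  (* The derivative of [u] has coefficient [lead_coef u *+ (size u).-1] in degree [(size u).-2]. *)
  apply: contraNneq lu => /(congr1 (fun p : {poly rat} => p`_(size u).-2)).
  rewrite coef_deriv coef0 lead_coefE; case: (size u) su => [|[|n]] //= _.
  by move/eqP; rewrite mulrn_eq0.
have T0 : T != 0.
  apply/eqP => eT.
  have : g %| g^`() ^+ 3.
    have -> : g^`() ^+ 3
        = g * (4%:P * g^`N(1) * g^`N(2) - 8%:P * g * g^`N(3)).
      by apply/eqP; rewrite -subr_eq0 -eT /T -poly.nderivn1; apply/eqP; ring.
    exact: dvdp_mulr.
  move/dvdp_gcd_idl/eqp_size => eg.
  have /eqP : coprimep g (g^`() ^+ 3) by rewrite coprimep_expr.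
  by rewrite eg => sg1; rewrite sg1 in sg.
have [al] := poly_non_root (mulf_neq0 g0 T0).
rewrite hornerM mulf_eq0 negb_or => /andP [gal Tal]; exists al; split=> //.
move: Tal; rewrite /T !(hornerE, hornerXn, horner_exp).
by [].
Qed.

(** * Binary forms and their dehomogenization *)

(* [x ^ (n - j) * y ^ j], for [j <= n]. *)
Definition bmon (n j : nat) : 'X_{1..2} := (U_(ord0) *+ (n - j) + U_(ord_max) *+ j)%MM.

Lemma bmonE n j : (bmon n j ord0 = n - j)%N /\ (bmon n j ord_max = j)%N.
Proof. by rewrite /bmon !mnmDE !mulmnE !mnm1E /= !mul0n !mul1n addn0. Qed.

Lemma mnm2P (m m' : 'X_{1..2}) :
  m ord0 = m' ord0 -> m ord_max = m' ord_max -> m = m'.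
Proof.
move=> e0 e1; apply/mnmP; case=> [[|[|//]] lt].
- by rewrite (_ : Ordinal lt = ord0) //; apply: val_inj.
- by rewrite (_ : Ordinal lt = ord_max) //; apply: val_inj.
Qed.

Lemma mdeg_bmon n j : (j <= n)%N -> mdeg (bmon n j) = n.
Proof. by move=> le; rewrite /bmon mdegD !mdegMn !mdeg1 !mul1n subnK. Qed.

(** In fixed degree, a monomial is determined by its exponent of [y]. *)
Lemma binary_form_sum (R : nzRingType) n (p : {mpoly R[2]}) : p \is n.-homog ->
  p = \sum_(j < n.+1) p@_(bmon n j) *: 'X_[bmon n j].
Proof.
move=> /dhomogP hp; apply/mpolyP => m; rewrite raddf_sum /=.
under eq_bigr do rewrite mcoeffZ mcoeffX.
have [dm|dm] := eqVneq (mdeg m) n.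
  have lt : (m ord_max < n.+1)%N.
    rewrite -dm mdegE big_ord_recl big_ord1 ltnS.
    by rewrite (_ : lift _ _ = ord_max) ?leq_addl //; apply: val_inj.
  have em : bmon n (m ord_max) = m.
    apply: mnm2P; rewrite ?(bmonE _ _).1 ?(bmonE _ _).2 //.
    rewrite -dm mdegE big_ord_recl big_ord1.
    by rewrite (_ : lift _ _ = ord_max) ?addnK //; apply: val_inj.
  rewrite (bigD1 (Ordinal lt)) //= em eqxx mulr1 big1 ?addr0 // => j ne.
  case: eqP => [e|]; last by rewrite mulr0.
  by case/eqP: ne; apply: val_inj; rewrite /= -e (bmonE _ _).2.
rewrite big1 => [|j _].
  by apply/eqP; rewrite mcoeff_eq0; apply: contra dm => /hp ->.
case: eqP => [e|]; last by rewrite mulr0.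
by rewrite -e mdeg_bmon ?eqxx // -ltnS in dm.
Qed.

Lemma mmap1_bmon (S : comNzRingType) (u v : S) n j :
  mmap1 (pair_val u v) (bmon n j) = u ^+ (n - j) * v ^+ j.
Proof.
rewrite /mmap1 big_ord_recl big_ord1 (_ : lift _ _ = ord_max); last exact: val_inj.
by rewrite (bmonE n j).1 (bmonE n j).2 /pair_val eqxx.
Qed.

Lemma mmap_binary_form (R : nzRingType) (S : comNzRingType) (f : {rmorphism R -> S})
  (u v : S) n (p : {mpoly R[2]}) : p \is n.-homog ->
  mmap f (pair_val u v) p = \sum_(j < n.+1) f p@_(bmon n j) * (u ^+ (n - j) * v ^+ j).
Proof.
move=> hp; rewrite {1}(binary_form_sum hp) raddf_sum /=.
by apply: eq_bigr => j _; rewrite mmapZ mmapX mmap1_bmon.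
Qed.

Lemma rmorph_mmap_binary_form (R S : comNzRingType) (h : {rmorphism R -> S})
  (u v : R) n (p : {mpoly int[2]}) : p \is n.-homog ->
  h (mmap (intr : int -> R) (pair_val u v) p)
  = mmap (intr : int -> S) (pair_val (h u) (h v)) p.
Proof.
move=> hp; rewrite !(mmap_binary_form _ _ _ hp) rmorph_sum.
by apply: eq_bigr => j _; rewrite !rmorphM !rmorphXn rmorph_int.
Qed.

Definition homogenize (n : nat) (p : {poly rat}) : {mpoly rat[2]} :=
  \sum_(j < n.+1) p`_j *: 'X_[bmon n j].

Definition frac_const : {rmorphism rat -> {fraction {mpoly rat[2]}}} :=
  (@tofrac {mpoly rat[2]}) \o (@mpolyC 2 rat).

(** In the fraction field homogenization is [x ^ n * p (y / x)], which makes multiplicativity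
    immediate. *)
Lemma homogenizeE n (p : {poly rat}) : (size p <= n.+1)%N ->
  tofrac (homogenize n p)
  = tofrac 'X_ord0 ^+ n * (map_poly frac_const p).[tofrac 'X_ord_max / tofrac 'X_ord0].
Proof.
move=> sp; rewrite /homogenize rmorph_sum /=.
rewrite (horner_coef_wide _ (n := n.+1)); last by rewrite size_map_poly.
rewrite mulr_sumr; apply: eq_bigr => j _.
have x0 : tofrac ('X_ord0 : {mpoly rat[2]}) != 0.
  by rewrite tofrac_eq0 -msize_poly_eq0 msizeX mdeg1.
rewrite -mul_mpolyC rmorphM coef_map /= mulrCA; congr (_ * _).
rewrite /bmon mpolyXD -!mpolyXn.
set x := tofrac 'X_ord0; have -> : x ^+ n = x ^+ (n - j) * x ^+ j.
  by rewrite -exprD subnK // -ltnS.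
rewrite rmorphM !rmorphXn expr_div_n -mulrA; congr (_ * _).
by rewrite mulrCA divff ?mulr1 // expf_neq0.
Qed.

Lemma homogenizeM m n (p q : {poly rat}) : (size p <= m.+1)%N -> (size q <= n.+1)%N ->
  homogenize (m + n) (p * q) = homogenize m p * homogenize n q.
Proof.
move=> sp sq; apply/eqP; rewrite -tofrac_eq rmorphM /= !homogenizeE //; last first.
  by apply: leq_trans (size_polyMleq _ _) _; lia.
by rewrite rmorphM hornerM exprD mulrACA.
Qed.

Lemma homogenize_const n p c : homogenize n p = c%:MP -> (0 < n)%N -> p`_n = 0.
Proof.
move=> /(congr1 (mcoeff (bmon n n))); rewrite raddf_sum /= => e n0.
move: e; rewrite (bigD1 ord_max) //= mcoeffZ mcoeffX eqxx mulr1 big1 => [|j ne].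
  rewrite addr0 mcoeffC => ->; case: eqP => [/mnmP /(_ ord_max)|]; last by rewrite mulr0.
  by rewrite (bmonE _ _).2 mnm0E => e; rewrite e in n0.
rewrite mcoeffZ mcoeffX; case: eqP => [/mnmP /(_ ord_max)|]; last by rewrite mulr0.
by rewrite !(bmonE _ _).2 => e; case/eqP: ne; apply: val_inj.
Qed.

(** This is [G (1, t)] with [t = y / x], whereas [dehomog] sets [y = 1]. Its leading coefficient is
    the coefficient of [y ^ 4]. *)
Definition slope_poly (G : {mpoly int[2]}) : {poly rat} :=
  \poly_(j < 5) (G@_(bmon 4 j))%:~R.

Lemma size_slope_poly (G : {mpoly int[2]}) :
  G@_(U_(ord_max) *+ 4) != 0 -> size (slope_poly G) = 5%N.
Proof.
move=> G4; apply: size_poly_eq; rewrite intr_eq0.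
by rewrite /bmon subnn mulm0n add0m.
Qed.

Lemma slope_poly_squarefree (G : {mpoly int[2]}) : G \is 4.-homog ->
  G@_(U_(ord_max) *+ 4) != 0 -> squarefree_form G ->
  forall h r : {poly rat}, slope_poly G = h ^+ 2 * r -> (size h <= 1)%N.
Proof.
move=> hG G4 sqf h r eg; rewrite leqNgt; apply/negP => sh.
have sg := size_slope_poly G4.
have g0 : slope_poly G != 0 by rewrite -size_poly_eq0 sg.
have h0 : h != 0 by apply: contraNneq g0 => h0; rewrite eg h0 expr0n mul0r.
have r0 : r != 0 by apply: contraNneq g0 => r0; rewrite eg r0 mulr0.
have := sg; rewrite eg expr2 !size_mul ?mulf_neq0 //.
have := h0; have := r0; rewrite -!size_poly_gt0 => sr0 sh0 sz.
set m := (size h).-1; set n := (size r).-1.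
have szh : size h = m.+1 by rewrite prednK.
have szr : size r = n.+1 by rewrite prednK.
(* The degree is exactly 4, so the homogenized factors multiply to [G] itself. *)
have e4 : (m + m + n = 4)%N by move: sz; rewrite szh szr; lia.
have shh : (size (h * h)%R <= (m + m).+1)%N.
  by apply: leq_trans (size_polyMleq _ _) _; rewrite szh; lia.
have m0 : (0 < m)%N by move: sh; rewrite szh.
have := sqf (homogenize m h) (homogenize n r).
case=> [|c /homogenize_const ec].
  rewrite expr2 -homogenizeM ?szh // -homogenizeM ?szr // e4 -expr2 -eg.
  rewrite {1}(binary_form_sum hG) raddf_sum /=; apply: eq_bigr => j _.
  by rewrite map_mpolyZ map_mpolyX coef_poly ltn_ord.
have := h0; rewrite -lead_coef_eq0 lead_coefE -/m ec ?eqxx //.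
Qed.

(** * Normal forms modulo the equation of the surface *)

Definition poly_ev (R S : comNzRingType) (f : {rmorphism R -> S}) (x : S) :
  {rmorphism {poly R} -> S} := horner_eval x \o map_poly f.

Lemma poly_evE (R S : comNzRingType) (f : {rmorphism R -> S}) (x : S) p :
  poly_ev f x p = (map_poly f p).[x].
Proof. by []. Qed.

Lemma poly_evC (R S : comNzRingType) (f : {rmorphism R -> S}) (x : S) c :
  poly_ev f x c%:P = f c.
Proof. by rewrite poly_evE map_polyC hornerC. Qed.

Lemma poly_evX (R S : comNzRingType) (f : {rmorphism R -> S}) (x : S) :
  poly_ev f x 'X = x.
Proof. by rewrite poly_evE map_polyX hornerX. Qed.

Lemma rmorph_poly_ev (R S T : comNzRingType) (f : {rmorphism R -> S})
  (h : {rmorphism S -> T}) (k : {rmorphism R -> T}) (x : S) p :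
  h \o f =1 k -> h (poly_ev f x p) = poly_ev k (h x) p.
Proof.
move=> e; rewrite !poly_evE -horner_map -map_poly_comp.
by congr (_.[_]); apply: eq_map_poly.
Qed.

(** The ring of polynomials in [x], [y], [z], with [z] outermost and [x] innermost, so that
    vanishing can be tested one variable at a time. *)
Definition poly3 := {poly {poly {poly rat}}}.

Definition embed2 : {rmorphism {poly {poly rat}} -> {mpoly rat[4]}} :=
  poly_ev (poly_ev (@mpolyC 4 rat) 'X_(inord 0)) 'X_(inord 1).

Lemma embed2Y : embed2 'X = 'X_(inord 1).
Proof. exact: poly_evX. Qed.

Lemma embed2X : embed2 'X%:P = 'X_(inord 0).
Proof. by rewrite /embed2 poly_evC poly_evX. Qed.

Definition embed3 : {rmorphism poly3 -> {mpoly rat[4]}} :=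
  poly_ev embed2 'X_(inord 2).

Lemma embed3Z : embed3 'X = 'X_(inord 2).
Proof. exact: poly_evX. Qed.

Lemma embed3C p : embed3 p%:P = embed2 p.
Proof. exact: poly_evC. Qed.

Definition eval3 (x y z : rat) : {rmorphism poly3 -> rat} :=
  poly_ev (poly_ev (horner_eval x) y) z.

Lemma meval_embed3 (v : 'I_4 -> rat) (A : poly3) :
  (embed3 A).@[v] = eval3 (v (inord 0)) (v (inord 1)) (v (inord 2)) A.
Proof.
rewrite -(mevalXU v (inord 2)); apply: rmorph_poly_ev => B /=.
rewrite -[v (inord 1)](mevalXU v); apply: rmorph_poly_ev => p /=.
rewrite (rmorph_poly_ev (k := idfun)); last by move=> c /=; rewrite mevalC.
by rewrite poly_evE map_poly_id //= mevalXU.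
Qed.

Definition form_poly (G : {mpoly int[2]}) : {poly {poly rat}} :=
  mmap (intr : int -> {poly {poly rat}}) (pair_val 'X%:P 'X) G.

Lemma embed2_form_poly (G : {mpoly int[2]}) : G \is 4.-homog ->
  embed2 (form_poly G)
  = mmap (fun a : int => a%:~R : {mpoly rat[4]})
         (pair_val 'X_(inord 0) 'X_(inord 1)) G.
Proof.
move=> hG; rewrite -embed2X -embed2Y.
exact: (rmorph_mmap_binary_form embed2 _ _ hG).
Qed.

Definition rhs_poly (G : {mpoly int[2]}) : poly3 := 'X ^+ 3 + (form_poly G)%:P * 'X.

Lemma surf_eq_embed3 (G : {mpoly int[2]}) : G \is 4.-homog ->
  surf_eq G = 'X_(inord 3) ^+ 2 - embed3 (rhs_poly G).
Proof.
move=> hG; rewrite /surf_eq /rhs_poly -embed2_form_poly //.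
by rewrite rmorphD rmorphXn rmorphM embed3Z embed3C opprD addrA.
Qed.

(** The equation is monic of degree 2 in [w]. The polynomials of the required shape contain 1 and
    are closed under sums and under multiplication by constants and variables. *)
Lemma reduce_mod_surf_eq (G : {mpoly int[2]}) (f : {mpoly rat[4]}) :
  G \is 4.-homog ->
  exists Q A B, f = Q * surf_eq G + embed3 A + 'X_(inord 3) * embed3 B.
Proof.
move=> hG; set S := surf_eq G; set w := 'X_(inord 3).
pose red f := exists Q A B, f = Q * S + embed3 A + w * embed3 B.
have redD f1 f2 : red f1 -> red f2 -> red (f1 + f2).
  move=> [Q1 [A1 [B1 ->]]] [Q2 [A2 [B2 ->]]]; exists (Q1 + Q2), (A1 + A2), (B1 + B2).
  by rewrite !rmorphD /=; ring.
have redM C f1 : red f1 -> red (embed3 C * f1).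
  move=> [Q [A [B ->]]]; exists (embed3 C * Q), (C * A), (C * B).
  by rewrite !rmorphM /=; ring.
have redw f1 : red f1 -> red (w * f1).
  (* Multiplication by [w] produces [w ^ 2 * B], and [w ^ 2] is [S] plus the right-hand side. *)
  move=> [Q [A [B ->]]]; exists (w * Q + embed3 B), (rhs_poly G * B), A.
  rewrite rmorphM.
  have -> : embed3 (rhs_poly G) = w ^+ 2 - S.
    by rewrite /S surf_eq_embed3 // subKr.
  ring.
have redX (i : 'I_4) f1 : red f1 -> red ('X_i * f1).
  have x0 : embed3 ('X%:P%:P) = 'X_(inord 0).
    by rewrite embed3C embed2X.
  have x1 : embed3 ('X%:P) = 'X_(inord 1) by rewrite embed3C embed2Y.
  have x2 : embed3 'X = 'X_(inord 2) by exact: embed3Z.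
  move=> r1; rewrite -[i]inord_val; case: i => [[|[|[|[|//]]]] lt] /=.
  - by rewrite -x0; apply: redM.
  - by rewrite -x1; apply: redM.
  - by rewrite -x2; apply: redM.
  - exact: redw.
rewrite -/(red f); elim/mpolyind: f => [|c m p _ _ redp].
  by exists 0, 0, 0; rewrite !rmorph0 mul0r mulr0 !addr0.
apply: redD => //; have -> : c *: 'X_[m] = embed3 (c%:P%:P%:P) * 'X_[m].
  by rewrite embed3C /embed2 !poly_evC mul_mpolyC.
apply: redM; rewrite mpolyXE_id; apply: big_rec => [|i y _ redy].
  by exists 0, 1, 0; rewrite rmorph1 rmorph0 mul0r mulr0 add0r addr0.
by elim: (m i) => [|n IH]; rewrite ?mul1r // exprS -mulrA; apply: redX.
Qed.

(** For fixed [x] and [n] there are infinitely many [z], then infinitely many [y = x * t n], then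
    infinitely many [x]. *)
Lemma poly3_eq0 (t : nat -> rat) (zs : nat -> nat -> rat) (A : poly3) :
  injective t -> (forall n, injective (zs n)) ->
  (forall x n k, x != 0 -> eval3 x (x * t n) (x ^+ 2 * zs n k) A = 0) -> A = 0.
Proof.
move=> inj_t inj_z A0; apply/polyP => i; apply/polyP => j; rewrite !coef0.
(* The successor keeps the values of [x] nonzero. *)
apply: (@poly_eq0_inj_roots _ _ (fun n => n.+1%:R)) => [n1 n2 /eqP|l].
  by rewrite eqr_nat => /eqP [].
set x : rat := l.+1%:R; have x0 : x != 0 by rewrite pnatr_eq0.
have Ai n : poly_ev (horner_eval x) (x * t n) A`_i = 0.
  have e : map_poly (poly_ev (horner_eval x) (x * t n)) A = 0.
    apply: (@poly_eq0_inj_roots _ _ (fun k => x ^+ 2 * zs n k)) => [k1 k2|k].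
      by move/(mulfI (expf_neq0 2 x0)); apply: inj_z.
    exact: A0.
  by rewrite -coef_map e coef0.
have e : map_poly (horner_eval x) A`_i = 0.
  apply: (@poly_eq0_inj_roots _ _ (fun n => x * t n)) => [n1 n2|n]; last exact: Ai.
  by move/(mulfI x0); apply: inj_t.
by rewrite -[_.[x]]/(horner_eval x _) -coef_map e coef0.
Qed.

(** * Rational points as homogeneous primes *)

Definition weight (i : 'I_4) : nat := nth 0%N [:: 1; 1; 2; 3]%N i.

(* Restriction of functions to the curve [(a_i s^(w_i))_i]: its kernel is the
   ideal of the point [a], which is therefore prime. *)
Definition orbit_map (a : 'I_4 -> rat) : {rmorphism {mpoly rat[4]} -> {poly rat}} :=
  mmap (@polyC rat) (fun i => a i *: 'X^(weight i)).

(** The substitution attaches [s ^ (wdeg m)] to the monomial [m], so powers of [s] sort the terms by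
    weighted degree. *)
Lemma coef_orbit_map (a : 'I_4 -> rat) (f : {mpoly rat[4]}) (d : nat) :
  (orbit_map a f)`_d = (pihomog wdeg d f).@[a].
Proof.
rewrite /orbit_map /= /mmap coef_sum /pihomog raddf_sum /= [RHS]big_mkcond /=.
apply: eq_bigr => m _; rewrite coefCM.
have -> : mmap1 (fun i => a i *: 'X^(weight i)) m = (\prod_i a i ^+ m i) *: 'X^(wdeg m).
  rewrite /mmap1 /wdeg -prodrXr -scaler_prod.
  by apply: eq_bigr => i _; rewrite exprZn -exprM.
rewrite coefZ coefXn eq_sym; case: eqP => _ /=; last by rewrite !mulr0.
by rewrite mevalZ mevalX mulr1.
Qed.

Lemma point_idealP (a : 'I_4 -> rat) (f : {mpoly rat[4]}) :
  point_ideal a f <-> orbit_map a f = 0.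
Proof.
split=> [h|e d]; last by rewrite -coef_orbit_map e coef0.
by apply/polyP => d; rewrite coef_orbit_map h coef0.
Qed.

Lemma orbit_mapXU (a : 'I_4 -> rat) i : orbit_map a 'X_i = a i *: 'X^(weight i).
Proof. by rewrite /orbit_map /= mmapX mmap1U. Qed.

Lemma Proj_point_ideal (a : 'I_4 -> rat) :
  (exists i, a i != 0) -> Proj (point_ideal a).
Proof.
move=> [i ai]; split; first split.
- split=> [|f h /point_idealP ef /point_idealP eh|f h /point_idealP eh].
  + by apply/point_idealP; rewrite rmorph0.
  + by apply/point_idealP; move: ef eh; rewrite rmorphD /= => -> ->; rewrite addr0.
  + by apply/point_idealP; move: eh; rewrite rmorphM /= => ->; rewrite mulr0.
- by move=> /point_idealP /eqP; rewrite rmorph1 oner_eq0.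
- move=> f h /point_idealP /eqP; rewrite rmorphM mulf_eq0.
  by case/orP => /eqP e; [left | right]; apply/point_idealP.
- move=> f If d e; have [->|ne] := eqVneq d e; first by rewrite pihomog_id.
  by rewrite (pihomog_ne0 ne (pihomogP _ _ _)) meval0.
- exists i => /point_idealP /eqP; rewrite orbit_mapXU scaler_eq0 (negPf ai) /=.
  by rewrite expf_eq0 polyX_eq0 andbF.
Qed.

Lemma meval_point_ideal (a : 'I_4 -> rat) (f : {mpoly rat[4]}) :
  point_ideal a f -> f.@[a] = 0.
Proof.
move=> If; rewrite [f](pihomog_partitionE (mf := wdeg) (leqnn _)) raddf_sum /=.
by apply: big1 => d _; apply: If.
Qed.

(** The representative of [(1 : t : z : w)] obtained by scaling with [x] in weights 1, 1, 2, 3. *)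
Definition fibre_point (x t z w : rat) (i : 'I_4) : rat :=
  nth 0 [:: x; x * t; x ^+ 2 * z; x ^+ 3 * w] i.

Lemma slope_polyE (G : {mpoly int[2]}) (S : comNzRingType) (h : {rmorphism rat -> S})
  (x t : S) : G \is 4.-homog ->
  mmap (intr : int -> S) (pair_val x (x * t)) G
  = x ^+ 4 * (map_poly h (slope_poly G)).[t].
Proof.
move=> hG; rewrite (mmap_binary_form _ _ _ hG).
rewrite (@horner_coef_wide _ 5); last first.
  by rewrite size_map_poly size_poly.
rewrite mulr_sumr; apply: eq_bigr => j _ /=.
rewrite coef_map coef_poly ltn_ord /= rmorph_int.
have -> : x ^+ 4 = x ^+ (4 - j) * x ^+ j by rewrite -exprD subnK // -ltnS.
by rewrite exprMn; ring.
Qed.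

Lemma surf_Q_fibre_point (G : {mpoly int[2]}) (x t z w : rat) : G \is 4.-homog ->
  x != 0 -> w ^+ 2 = z ^+ 3 + (slope_poly G).[t] * z ->
  surf_Q G (point_ideal (fibre_point x t z w)).
Proof.
move=> hG x0 ew; set a := fibre_point x t z w.
have a0 : exists i, a i != 0 by exists ord0.
split; last by exists a.
split=> [|_ ->]; first exact: Proj_point_ideal.
apply/point_idealP; rewrite /surf_eq !rmorphB !rmorphXn rmorphM.
rewrite [orbit_map a (mmap _ _ _)](rmorph_mmap_binary_form (orbit_map a) _ _ hG).
rewrite !orbit_mapXU.
rewrite /weight /a /fibre_point !inordK //= expr1.
have -> : (x * t) *: 'X = (x *: 'X) * t%:P :> {poly rat}.
  by rewrite -!mul_polyC polyCM; ring.
rewrite (slope_polyE (@polyC rat)) // horner_map /= -!mul_polyC.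
(* The equation is weighted homogeneous of degree 6. *)
transitivity ((x ^+ 6)%:P * 'X^6 *
  (w ^+ 2 - (z ^+ 3 + (slope_poly G).[t] * z))%:P); last first.
  by rewrite ew subrr mulr0.
by rewrite !(polyCB, polyCD, polyCM, polyC_exp); ring.
Qed.

(** * Density *)

(** Write [f] as [A + w * B] modulo the equation. Both signs of [w] give points, so [A] and [w * B]
    vanish separately, and [B] vanishes because [w] is nonzero. As [f] may be inhomogeneous, it is
    evaluated at every representative scaled by [x]. *)
Lemma vanishing_on_surf_Q (G : {mpoly int[2]}) (f : {mpoly rat[4]})
  (t : nat -> rat) (zs : nat -> nat -> rat) : G \is 4.-homog ->
  injective t -> (forall n, injective (zs n)) ->
  (forall n k, exists2 w, w != 0 &
     w ^+ 2 = zs n k ^+ 3 + (slope_poly G).[t n] * zs n k) ->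
  (forall P, surf_Q G P -> P f) -> exists Q, f = Q * surf_eq G.
Proof.
move=> hG inj_t inj_z pts f0.
have [Q [A [B ef]]] := reduce_mod_surf_eq f hG.
have ev x n k w : x != 0 -> w ^+ 2 = zs n k ^+ 3 + (slope_poly G).[t n] * zs n k ->
   eval3 x (x * t n) (x ^+ 2 * zs n k) A
   + x ^+ 3 * w * eval3 x (x * t n) (x ^+ 2 * zs n k) B = 0.
  move=> x0 ew; have sQ := surf_Q_fibre_point hG x0 ew.
  set a := fibre_point _ _ _ _ in sQ.
  have := meval_point_ideal (f0 _ sQ).
  have sv : (surf_eq G).@[a] = 0.
    by apply: meval_point_ideal; case: sQ => [[_ Ps] _]; apply: Ps.
  rewrite ef 2!mevalD (mevalM _ Q) sv mulr0 add0r mevalM !meval_embed3 mevalXU.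
  by rewrite /a /fibre_point !inordK.
have A0 : A = 0.
  apply: (poly3_eq0 inj_t inj_z) => x n k x0.
  have [w w0 ew] := pts n k; have e1 := ev x n k w x0 ew.
  have := ev x n k (- w) x0; rewrite sqrrN => /(_ ew) e2.
  have := congr2 +%R e1 e2; rewrite mulrN mulNr addrACA subrr !addr0 => /eqP.
  by rewrite -mulr2n mulrn_eq0 => /eqP.
have B0 : B = 0.
  apply: (poly3_eq0 inj_t inj_z) => x n k x0.
  have [w w0 ew] := pts n k; have := ev x n k w x0 ew.
  rewrite A0 rmorph0 add0r => /eqP; rewrite mulf_eq0.
  by rewrite (negPf (mulf_neq0 (expf_neq0 3 x0) w0)) => /eqP.
by exists Q; rewrite ef A0 B0 !rmorph0 mulr0 !addr0.
Qed.

Theorem theorem2p3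
  (G : {mpoly int[2]}) (G_homog : G \is 4.-homog) (G_sqfree : squarefree_form G)
  (G_x4 : G@_(U_(ord0) *+ 4) != 0) (G_y4 : G@_(U_(ord_max) *+ 4) != 0)
  (G1 : {mpoly int[2]}) (G_G1 : G = content G *: G1)
  (G1_nofix : ~ has_fixed_prime_divisor G1)
  (g : seq {mpoly int[2]})
  (g_irr : forall h, h \in g ->
     irreducible_elt h /\ exists d : nat, h \is d.-homog)
  (G1_prod : G1 = \prod_(h <- g) h)
  (g_mu4 : exists2 h, h \in g &
     forall u : quotQ (dehomog h), ~~ (4.-primitive_root u))
  (sha_fin : forall E : weierstrass rat,
     wdisc E != 0 -> wj E = 1728 -> sha_finite E) :
  zariski_dense_in (surf_Q G) (surf G).
Proof.
have sz := size_slope_poly G_y4.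
have [|al [al0 T0]] := exists_good_parameter _
  (slope_poly_squarefree G_homog G_y4 G_sqfree); first by rewrite sz.
have [|t [zs [inj_t inj_z pts]]] := infinitely_many_fibres _ al0 T0.
  by rewrite sz.
(* Each equation of a closed set containing the rational points is a multiple of [surf_eq G], hence
   lies in every prime of the surface. *)
move=> Z [S ZS] sub P [projP surfP]; apply/ZS; split=> // f Sf.
have [|Q ->] := vanishing_on_surf_Q (f := f) G_homog inj_t inj_z pts.
  by move=> P' /sub /ZS [_]; apply.
by case: projP => [[[_ _ PM] _ _] _ _]; apply: PM; apply: surfP.
Qed.
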